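(* Let $G$ be an edge-colored complete graph $K_n$ using exactly $n$ colors which contains no properly colored $C_4$. Then $G$ contains at least one of the following: (1) a vertex all of whose incident edges have a single color; (2) a rainbow triangle $uvw$, say with $uv$ red, $vw$ blue and $uw$ green (three distinct colors), such that all other edges incident to $u$ are red, all other edges incident to $v$ are blue, and all other edges incident to $w$ are green; (3) a vertex $v$ whose incident edges all have pairwise distinct colors, while all other edges of $G$ have one single color, distinct from the colors of the edges incident to $v$.
   Context: Graphs are finite and simple. An edge-colored graph is a graph with an arbitrary assignment of a color to each edge (not necessarily proper). A subgraph is rainbow if all its edges have distinct colors, and properly colored if any two of its adjacent edges have distinct colors. $C_4$ is the cycle on 4 vertices, as a (not necessarily induced) subgraph. *)

(* Defs.v *)
From mathcomp Require Import all_boot.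
Set Implicit Arguments.
Unset Strict Implicit.
Unset Printing Implicit Defensive.

(* An edge is a 2-element set of vertices, and a subgraph is given by its set
   of edges. *)
Definition complete_edges (V : finType) : {set {set V}} :=
  [set e : {set V} | #|e| == 2].

Definition incident_edges (V : finType) (v : V) : {set {set V}} :=
  [set e in complete_edges V | v \in e].

Definition cycle4 (V : finType) (x y z t : V) : {set {set V}} :=
  [set [set x; y]; [set y; z]; [set z; t]; [set t; x]].

Definition triangle (V : finType) (u v w : V) : {set {set V}} :=
  [set [set u; v]; [set v; w]; [set u; w]].

(* An edge-coloring of the complete graph on V is represented by a function
   col : {set V} -> C; its values on sets that are not edges are irrelevant and
   are never used below. *)

Definition used_colors (V : finType) (C : eqType) (col : {set V} -> C) :
  seq C :=
  undup [seq col e | e in complete_edges V].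

Definition rainbow (V : finType) (C : eqType) (col : {set V} -> C)
    (H : {set {set V}}) : Prop :=
  forall e f, e \in H -> f \in H -> e != f -> col e != col f.

Definition properly_colored (V : finType) (C : eqType) (col : {set V} -> C)
    (H : {set {set V}}) : Prop :=
  forall e f, e \in H -> f \in H -> e != f -> e :&: f != set0 ->
    col e != col f.

Definition has_properly_colored_C4 (V : finType) (C : eqType)
    (col : {set V} -> C) : Prop :=
  exists x y z t : V,
    uniq [:: x; y; z; t] /\ properly_colored col (cycle4 x y z t).

Definition has_monochromatic_vertex (V : finType) (C : eqType)
    (col : {set V} -> C) : Prop :=
  exists (v : V) (a : C), forall e, e \in incident_edges v -> col e = a.

Definition has_dominating_rainbow_triangle (V : finType) (C : eqType)
    (col : {set V} -> C) : Prop :=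
  exists u v w : V,
    [/\ uniq [:: u; v; w],
        rainbow col (triangle u v w),
        forall e, e \in incident_edges u :\: triangle u v w ->
          col e = col [set u; v],
        forall e, e \in incident_edges v :\: triangle u v w ->
          col e = col [set v; w]
      & forall e, e \in incident_edges w :\: triangle u v w ->
          col e = col [set u; w] ].

Definition has_rainbow_vertex_mono_rest (V : finType) (C : eqType)
    (col : {set V} -> C) : Prop :=
  exists (v : V) (a : C),
    [/\ rainbow col (incident_edges v),
        forall e, e \in complete_edges V :\: incident_edges v -> col e = a
      & forall e, e \in incident_edges v -> col e != a].

(* Main.v *)
(** Say that a color is exclusive to a vertex [v] if all its edges contain [v].
    An induction on the number of vertices shows that [k] vertices span at most
    [k] colors, so here every vertex has an exclusive color. Call an edge
    singular if no other edge has its color; two disjoint singular edges lie in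
    a properly colored [C_4]. Let [T] be the set of vertices on no singular edge.
    Avoiding a properly colored [C_4] forces each [x] in [T] to send a single
    color [s x] to the complement of [T], and each edge inside [T] to have the
    color [s x] of one of its ends [x], which orients it. The resulting
    tournament has no directed 4-cycle, so its top strong component is one
    vertex or a cyclic triangle: cases (1) and (2). If [T] is empty, the singular
    edges pairwise meet and cover all vertices, hence contain a spanning star;
    counting colors gives case (3). *)
Require Import Defs.
From mathcomp Require Import all_boot.
Set Implicit Arguments.
Unset Strict Implicit.
Unset Printing Implicit Defensive.

(** * Tournaments without directed 4-cycles *)

(* Any vertex beating one vertex of a 3-cycle beats all three. If a vertex [u] of
   maximum out-degree is beaten, it lies on a 3-cycle, and a further vertex
   beating [u] would close a 4-cycle. *)
Lemma tournament_no_C4 (V : finType) (T : {set V}) (d : rel V) (x0 : V) :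
  x0 \in T ->
  {in T &, forall x y, x != y -> d x y (+) d y x} ->
  {in T & &, forall x y z, {in T, forall t, uniq [:: x; y; z; t] ->
    ~ [/\ d x y, d y z, d z t & d t x]}} ->
  (exists2 u, u \in T & {in T, forall x, x != u -> d u x}) \/
  exists u v w, [/\ [/\ u \in T, v \in T & w \in T], uniq [:: u; v; w],
    [/\ d u v, d v w & d w u] &
    {in T, forall x, x \notin [:: u; v; w] -> [/\ d u x, d v x & d w x]}].
Proof.
move=> x0T tour noC4.
(* The condition [y != x] is imposed because [d x x] is arbitrary. *)
pose N x := [set y in T | (y != x) && d x y].
have [u] := arg_maxnP (fun x => #|N x|) x0T.
rewrite -/(u \in T) => uT umax.
have tourN x y : x \in T -> y \in T -> x != y -> ~~ d x y -> d y x.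
  by move=> xT yT xy; have := tour _ _ xT yT xy; case: (d x y).
have asym x y : x \in T -> y \in T -> x != y -> d x y -> d y x -> False.
  by move=> xT yT xy; have := tour _ _ xT yT xy; case: (d x y); case: (d y x).
have up a b c x : a \in T -> b \in T -> c \in T -> x \in T ->
    uniq [:: a; b; c; x] -> [/\ d a b, d b c & d c a] -> d x a -> d x b /\ d x c.
  move=> aT bT cT xT; rewrite /= !inE !negb_or.
  case/and4P=> /and3P[ab ac ax] /andP[bc bx] cx _ [dab dbc dca] dxa.
  have dxc : d x c.
    apply: tourN; rewrite // 1?eq_sym //; apply/negP=> dcx.
    apply: (noC4 x a b xT aT bT c cT) => //.
    by rewrite /= !inE !negb_or ![x == _]eq_sym ab ac bc ax bx cx.
  split=> //; apply: tourN; rewrite // 1?eq_sym //; apply/negP=> dbx.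
  apply: (noC4 x c a xT cT aT b bT) => //.
  by rewrite /= !inE !negb_or ![x == _]eq_sym ![c == _]eq_sym ac bc ab ax bx eq_sym cx.
have back w : w \in T -> w != u -> d w u ->
    exists v, [/\ v \in T, v != u, v != w, d u v & d v w].
  move=> wT wu dwu.
  (* If [N u] were contained in [N w], which also contains [u], the degree of [w] would exceed the
     maximum. *)
  have [sub|/subsetPn[v]] := boolP (N u \subset N w).
    have /proper_card : N u \proper N w.
      apply/properP; split=> //; exists u; last by rewrite !inE eqxx andbF.
      by rewrite inE uT eq_sym wu.
    by rewrite ltnNge; case/negP; exact: umax.
  rewrite !inE => /and3P[vT vu duv]; rewrite vT /= negb_and negbK => nv.
  have vw : v != w by apply/eqP=> vw; subst v; case: (asym _ _ wT uT wu).
  exists v; split=> //.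
  by move: nv; rewrite (negPf vw) /=; apply: tourN; rewrite // eq_sym.
have [/'forall_implyP dom|] :=
  boolP [forall x in T, (x != u) ==> d u x].
  by left; exists u => // x xT xu; exact: (implyP (dom x xT)).
rewrite negb_forall_in => /'exists_andP[w [wT]].
rewrite negb_imply => /andP[wu /tourN dwu'].
have {dwu'}dwu : d w u by apply: dwu'; rewrite // eq_sym.
have [v [vT vu vw duv dvw]] := back w wT wu dwu.
right; exists u, v, w; split=> //.
  by rewrite /= !inE negb_or eq_sym vu eq_sym wu vw.
move=> x xT; rewrite !inE !negb_or => /and3P[xu xv xw].
have dux : d u x.
  apply: contraT => /tourN dxu'.
  have {dxu'}dxu : d x u by apply: dxu'; rewrite // eq_sym.
  have [|//|//|dxv dxw] := up u v w x uT vT wT xT.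
    by rewrite /= !inE !negb_or ![u == _]eq_sym ![_ == x]eq_sym vu wu xu vw xv xw.
  (* This [y] closes the cycle [x -> w -> u -> y -> x]; it is neither [v] nor [w], since [x] beats
     both. *)
  have [y [yT yu yx duy dyx]] := back x xT xu dxu.
  have yv : y != v by apply/eqP=> yv; subst y; case: (asym _ _ vT xT yx).
  have yw : y != w by apply/eqP=> yw; subst y; case: (asym _ _ wT xT yx).
  case: (noC4 x w u xT wT uT y yT) => //.
  by rewrite /= !inE !negb_or xw xu ![_ == y]eq_sym yx wu yw yu.
split=> //.
  apply: contraT => /tourN dxv'.
  have {dxv'}dxv : d x v by apply: dxv'; rewrite // eq_sym.
  have [|//|//|_ dxu] := up v w u x vT wT uT xT.
    by rewrite /= !inE !negb_or ![_ == x]eq_sym vu vw wu xv xw xu.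
  by case: (asym _ _ xT uT xu).
apply: contraT => /tourN dxw'.
have {dxw'}dxw : d x w by apply: dxw'; rewrite // eq_sym.
have [|//|//|dxu _] := up w u v x wT uT vT xT.
  by rewrite /= !inE !negb_or ![_ == x]eq_sym [w == v]eq_sym [u == v]eq_sym wu vw vu xw xu xv.
by case: (asym _ _ xT uT xu).
Qed.

(** * Exclusive colors and singular edges *)

Section EdgeColoring.

Variables (V : finType) (C : eqType) (col : {set V} -> C).

Local Notation c u v := (col [set u; v]).

Lemma colorC (u v : V) : c u v = c v u.
Proof. by rewrite setUC. Qed.

Hypothesis noC4 : ~ has_properly_colored_C4 col.

(** Opposite sides of the cycle are disjoint, so only the four consecutive pairs can violate
    properness. *)
Lemma C4_not_properly_colored (x y z t : V) : uniq [:: x; y; z; t] ->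
  [|| c x y == c y z, c y z == c z t, c z t == c t x | c t x == c x y].
Proof.
move=> xyzt; apply: contraT; rewrite !negb_or => /and4P[h1 h2 h3 h4].
case: noC4; exists x, y, z, t; split=> //.
have [d1 d2] : [set x; y] :&: [set z; t] = set0 /\ [set y; z] :&: [set t; x] = set0.
  move: xyzt; rewrite /= !inE !negb_or.
  case/and4P=> /and3P[xy xz xt] /andP[yz yt] zt _.
  split; apply/eqP; rewrite setI_eq0 disjoints_subset; apply/subsetP=> p;
    rewrite !inE => /orP[]/eqP->; rewrite negb_or.
  - by rewrite xz xt.
  - by rewrite yz yt.
  - by rewrite yt eq_sym xy.
  - by rewrite zt eq_sym xz.
move=> e f; rewrite !inE -!orbA.
have eqsC (p q : C) : p != q -> q != p by rewrite eq_sym.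
case/or4P=> /eqP->; case/or4P=> /eqP->; rewrite ?eqxx //.
all: rewrite ?(setIC [set z; t]) ?(setIC [set t; x]) ?d1 ?d2 ?eqxx // => _ ?; auto.
Qed.

(* The color [a] need not occur in [X]. *)
Definition exclusive (X : {set V}) (v : V) (a : C) : bool :=
  [forall x in X, forall y in X, (x != y) && (c x y == a) ==> (v \in [:: x; y])].

Lemma exclusiveP (X : {set V}) (v : V) (a : C) :
  reflect {in X &, forall x y, x != y -> c x y = a -> v = x \/ v = y}
          (exclusive X v a).
Proof.
apply: (iffP 'forall_implyP) => [h x y xX yX xy cxy|h x xX].
  have /'forall_implyP/(_ y yX) := h x xX.
  by rewrite xy cxy eqxx !inE => /orP[]/eqP; [left | right].
apply/'forall_implyP=> y yX; apply/implyP=> /andP[xy /eqP cxy].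
by rewrite !inE; case: (h x y xX yX xy cxy) => ->; rewrite eqxx ?orbT.
Qed.

Lemma exclusive_neq (X : {set V}) (v x y : V) (a : C) :
  exclusive X v a -> x \in X -> y \in X -> x != y -> v != x -> v != y ->
  c x y != a.
Proof.
move=> /exclusiveP ex xX yX xy vx vy; apply/eqP=> /(ex x y xX yX xy).
by case=> /eqP; apply/negP.
Qed.

(** Exclusivity to both ends forces every edge of this color inside [X] to be [[set v; w]]
    itself. *)
Definition singular (X : {set V}) (v w : V) : bool :=
  [&& v != w, exclusive X v (c v w) & exclusive X w (c v w)].

Lemma singularC (X : {set V}) (v w : V) : singular X v w = singular X w v.
Proof. by rewrite /singular eq_sym colorC; congr (_ && _); exact: andbC. Qed.

(** In the cycle [v w x y] the two singular edges are opposite, so each consecutive pair contains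
    one of them and has two colors. *)
Lemma singular_intersect (X : {set V}) (v w x y : V) :
  {subset [:: v; w; x; y] <= X} -> singular X v w -> singular X x y ->
  ~~ uniq [:: v; w; x; y].
Proof.
move=> sX /and3P[_ ev ew] /and3P[_ ex ey]; apply/negP=> uq.
have [vX wX xX yX] : [/\ v \in X, w \in X, x \in X & y \in X].
  by split; apply: sX; rewrite !inE eqxx ?orbT.
have := C4_not_properly_colored uq.
move: uq; rewrite /= !inE !negb_or.
case/and4P=> /and3P[vw vx vy] /andP[wx wy] xy _.
rewrite [_ == c w x]eq_sym [_ == c y v]eq_sym.
rewrite (negPf (exclusive_neq ev wX xX wx vw vx)).
have [yw yx] : y != w /\ y != x by rewrite ![y == _]eq_sym.
have [yv xv wv] : [/\ y != v, x != v & w != v] by rewrite ![_ == v]eq_sym.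
rewrite (negPf (exclusive_neq ey wX xX wx yw yx)).
rewrite (negPf (exclusive_neq ex yX vX yv xy xv)).
by rewrite (negPf (exclusive_neq ew yX vX yv wy wv)).
Qed.

(** If [x != w2], the cycle [v w1 x w2] is properly colored: the colors of [w1 x] and [v w2] are
    exclusive to [w1] and [v], so the edge [x w2] has neither. *)
Lemma exclusive_fan (X : {set V}) (v w1 w2 x : V) :
  {subset [:: v; w1; w2; x] <= X} -> v != w1 -> v != w2 -> w1 != x ->
  exclusive X v (c v w1) -> exclusive X v (c v w2) -> c v w1 != c v w2 ->
  exclusive X w1 (c w1 x) -> c w1 x != c v w1 -> x = w2.
Proof.
move=> sX vw1 vw2 w1x ev1 ev2 n12 ew nx; apply/eqP; apply: contraT => xw2.
have [vX w1X w2X xX] : [/\ v \in X, w1 \in X, w2 \in X & x \in X].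
  by split; apply: sX; rewrite !inE eqxx ?orbT.
have vx : v != x by apply: contraNneq nx => <-; rewrite colorC.
have w12 : w1 != w2 by apply: contraNneq n12 => <-.
have := @C4_not_properly_colored v w1 x w2.
rewrite /= !inE !negb_or vw1 vx vw2 w1x w12 xw2 => /(_ isT).
rewrite eq_sym (negPf nx) eq_sym (negPf (exclusive_neq ew xX w2X xw2 w1x w12)).
rewrite [c w2 v]colorC (negPf (exclusive_neq ev2 xX w2X xw2 vx vw2)).
by rewrite eq_sym (negPf n12).
Qed.

Lemma exclusive_not_singular (X : {set V}) (x y : V) :
  exclusive X x (c x y) -> ~~ exclusive X y (c x y) ->
  exists z, [/\ z \in X, x != z, z != y & c x z = c x y].
Proof.
move=> /exclusiveP ex; rewrite negb_forall_in => /'exists_andP[p [pX]].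
rewrite negb_forall_in => /'exists_andP[q [qX]].
rewrite negb_imply !inE negb_or => /andP[/andP[pq /eqP cpq] /andP[yp yq]].
case: (ex p q pX qX pq cpq) => xE; subst x.
  by exists q; rewrite [q == y]eq_sym yq; split.
by exists p; rewrite eq_sym pq [p == y]eq_sym yp colorC; split.
Qed.

(** Take [z] outside [v], [w] with [x z] colored like [x y]. In the cycle [v w x z] only the edges
    [w x] and [x z] can agree. One takes [z = y], or, if [y = v], another edge of that color at [x],
    which exists because the color is not exclusive to [y]. *)
Lemma color_to_singular (X : {set V}) (v w x y : V) :
  {subset [:: v; w; x; y] <= X} -> singular X v w ->
  v != x -> w != x -> x != y -> exclusive X x (c x y) ->
  ~~ exclusive X y (c x y) -> c x w = c x y.
Proof.
move=> sX /and3P[vw ev ew] vx wx xy ex ny.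
have [vX wX xX yX] : [/\ v \in X, w \in X, x \in X & y \in X].
  by split; apply: sX; rewrite !inE eqxx ?orbT.
have gen z : z \in X -> z != v -> z != w -> x != z -> c x z = c x y ->
    c x w = c x y.
  move=> zX zv zw xz cxz.
  have := @C4_not_properly_colored v w x z.
  rewrite /= !inE !negb_or vw vx wx xz [v == z]eq_sym zv [w == z]eq_sym zw.
  move=> /(_ isT); rewrite eq_sym (negPf (exclusive_neq ev wX xX wx vw vx)).
  rewrite [_ == c z v]eq_sym -cxz.
  have [wz [xv wv]] : w != z /\ x != v /\ w != v.
    by rewrite [w == z]eq_sym ![_ == v]eq_sym.
  rewrite -cxz in ex; rewrite (negPf (exclusive_neq ex zX vX zv xz xv)).
  rewrite (negPf (exclusive_neq ew zX vX zv wz wv)).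
  by rewrite colorC !orbF => /eqP.
have [<- //|yw] := eqVneq y w.
have [yv|yv] := eqVneq y v; last exact: (gen y).
have [z [zX xz zy cxz]] := exclusive_not_singular ex ny.
have [<- //|zw] := eqVneq z w.
by apply: (gen z); rewrite // -yv.
Qed.

(** * At most as many colors as vertices *)

Definition colors_in (X : {set V}) : seq C :=
  undup [seq col e | e : {set V} in [set e in complete_edges V | e \subset X]].

Lemma colors_inP (X : {set V}) (a : C) :
  reflect (exists x y, [/\ x \in X, y \in X, x != y & a = c x y])
          (a \in colors_in X).
Proof.
rewrite mem_undup; apply: (iffP imageP) => [[e]|[x [y [xX yX xy ->]]]].
  rewrite !inE => /andP[/cards2P[x [y [xy ->]]]].
  by rewrite subUset !sub1set => /andP[xX yX] ->; exists x, y.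
exists [set x; y] => //.
by rewrite !inE cards2 xy subUset !sub1set xX yX.
Qed.

(** A color that disappears with [v] has all its edges at [v]. *)
Lemma exclusive_out (X : {set V}) (v : V) (a : C) :
  a \in colors_in X -> a \notin colors_in (X :\ v) ->
  exists w, [/\ w \in X, v != w, c v w = a & exclusive X v a].
Proof.
move=> /colors_inP[x [y [xX yX xy ->]]] na.
have ev : exclusive X v (c x y).
  apply/exclusiveP=> p q pX qX pq cpq; have [->|vp] := eqVneq v p; first by left.
  have [->|vq] := eqVneq v q; first by right.
  case/negP: na; apply/colors_inP; exists p, q.
  by rewrite !inE eq_sym vp eq_sym vq.
case/exclusiveP/(_ x y xX yX xy erefl): (ev) => vE; subst v.
  by exists y.
by exists x; rewrite eq_sym xy colorC.
Qed.

Lemma size_new_colors (X : {set V}) (v : V) :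
  size (colors_in X) <=
  size [seq a <- colors_in X | a \notin colors_in (X :\ v)]
  + size (colors_in (X :\ v)).
Proof.
rewrite -(count_predC (mem (colors_in (X :\ v)))) addnC !size_filter leq_add2l.
rewrite -size_filter; apply: uniq_leq_size; first exact/filter_uniq/undup_uniq.
by move=> a; rewrite mem_filter => /andP[].
Qed.

Lemma two_exclusive (X : {set V}) (v : V) :
  (size (colors_in (X :\ v))).+1 < size (colors_in X) ->
  exists w1 w2, [/\ [/\ w1 \in X, w2 \in X, v != w1 & v != w2],
    c v w1 != c v w2, exclusive X v (c v w1) & exclusive X v (c v w2)].
Proof.
move=> lt; have := leq_trans lt (size_new_colors X v).
rewrite -addn2 addnC leq_add2r.
set s := filter _ _ => s2.
have us : uniq s by exact/filter_uniq/undup_uniq.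
have mem_s a : a \in s -> exists w, [/\ w \in X, v != w, c v w = a & exclusive X v a].
  by rewrite mem_filter => /andP[na aX]; exact: exclusive_out.
case: s s2 us mem_s => [|a [|b s]] //= _ /andP[]; rewrite inE negb_or.
move=> /andP[ab _] _ mem_s.
have [w1 [w1X vw1 c1 e1]] := mem_s a (mem_head _ _).
have := mem_s b; rewrite !inE eqxx orbT => /(_ isT)[w2 [w2X vw2 c2 e2]].
by exists w1, w2; rewrite c1 c2; split.
Qed.

(** In a minimal counterexample every vertex has two exclusive colors. This yields a triangle of
    singular edges, which must cover [X]; but a triangle has only three colors. *)
Lemma size_colors_in (X : {set V}) : size (colors_in X) <= #|X|.
Proof.
have [k] := ubnP #|X|; elim: k X => // k IH X; rewrite ltnS => Xk.
rewrite leqNgt; apply/negP=> big.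
have out v : v \in X -> exists w1 w2,
    [/\ [/\ w1 \in X, w2 \in X, v != w1 & v != w2],
    c v w1 != c v w2, exclusive X v (c v w1) & exclusive X v (c v w2)].
  move=> vX; apply: two_exclusive; apply: leq_trans big.
  by move: Xk; rewrite (cardsD1 v) vX !add1n !ltnS; exact: IH.
have [v vX] : exists v, v \in X.
  case E: (colors_in X) big => [//|a l] _.
  have : a \in colors_in X by rewrite E mem_head.
  by case/colors_inP=> x [y [xX *]]; exists x.
have [w1 [w2 [[w1X w2X vw1 vw2] n12 e1 e2]]] := out v vX.
(* By [exclusive_fan], an edge at [p] with a color exclusive to [p] either has the color of [v p] or
   ends at [q]. As [p] has two such colors, both possibilities occur. *)
have tri p q : p \in X -> q \in X -> v != p -> v != q -> c v p != c v q ->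
    exclusive X v (c v p) -> exclusive X v (c v q) ->
    exclusive X p (c v p) /\ exclusive X p (c p q).
  move=> pX qX vp vq npq ep eq.
  have [y1 [y2 [[y1X y2X py1 py2] ny ey1 ey2]]] := out p pX.
  have fan x : x \in X -> p != x -> exclusive X p (c p x) -> c p x != c v p -> x = q.
    move=> xX px ex; apply: exclusive_fan vp vq px ep eq npq ex => z.
    by rewrite !inE => /or4P[] /eqP->.
  have [E1|/(fan _ y1X py1 ey1) E1] := eqVneq (c p y1) (c v p).
    rewrite -E1; split=> //; rewrite -(fan y2) // -E1 eq_sym //.
  have [E2|/(fan _ y2X py2 ey2) E2] := eqVneq (c p y2) (c v p).
    by rewrite -E2 -E1.
  by rewrite E1 E2 eqxx in ny.
have [e1' e12] := tri w1 w2 w1X w2X vw1 vw2 n12 e1 e2.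
rewrite eq_sym in n12; have [e2' e21] := tri w2 w1 w2X w1X vw2 vw1 n12 e2 e1.
have w12 : w1 != w2 by apply: contraNneq n12 => ->.
have s1 : singular X v w1 by rewrite /singular vw1 e1.
have s2 : singular X v w2 by rewrite /singular vw2 e2.
have s12 : singular X w1 w2 by rewrite /singular w12 e12 colorC.
have cover x : x \in X -> x \in [:: v; w1; w2].
  move=> xX; apply: contraT; rewrite !inE !negb_or => /and3P[xv xw1 xw2].
  (* Otherwise both exclusive colors of [x] would be the color of [x w1], by [color_to_singular]. *)
  have [y yX sxy] : exists2 y, y \in X & singular X x y.
    have [y1 [y2 [[y1X y2X xy1 xy2] ny ey1 ey2]]] := out x xX.
    have [f1|nf1] := boolP (exclusive X y1 (c x y1)).
      by exists y1 => //; rewrite /singular xy1 ey1.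
    have [f2|nf2] := boolP (exclusive X y2 (c x y2)).
      by exists y2 => //; rewrite /singular xy2 ey2.
    have to_w1 y : y \in X -> x != y -> exclusive X x (c x y) ->
        ~~ exclusive X y (c x y) -> c x w1 = c x y.
      move=> yX; apply: color_to_singular s1 _ _; rewrite 1?eq_sym // => z.
      by rewrite !inE => /or4P[] /eqP->.
    by rewrite -(to_w1 y1) // -(to_w1 y2) // eqxx in ny.
  have xy : x != y by case/and3P: sxy.
  have meet p q : p \in X -> q \in X -> p != q -> singular X p q ->
      x != p -> x != q -> y != p -> y != q -> False.
    move=> pX qX pq spq xp xq yp yq.
    suff /negP[] : ~~ uniq [:: p; q; x; y].
      by rewrite /= !inE !negb_or pq xy ![p == _]eq_sym ![q == _]eq_sym xp xq yp yq.
    apply: singular_intersect spq sxy => z.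
    by rewrite !inE => /or4P[] /eqP->.
  (* Some side of the triangle avoids [y], hence is disjoint from the singular edge [x y]. *)
  have [yv|yv] := eqVneq y v; first by case: (meet w1 w2); rewrite // yv.
  have [yw|yw] := eqVneq y w1; last by case: (meet v w1).
  by case: (meet v w2); rewrite // yw // eq_sym.
move: big; rewrite ltnNge => /negP[]; apply: (@leq_trans 3).
  apply: (@uniq_leq_size _ _ [:: c v w1; c v w2; c w1 w2]) (undup_uniq _) _.
  move=> a /colors_inP[x [y [/cover + /cover + + ->]]].
  rewrite !inE => /or3P[]/eqP-> /or3P[]/eqP->; rewrite ?eqxx ?orbT //.
  - by rewrite [c w1 v]colorC eqxx.
  - by rewrite [c w2 v]colorC eqxx ?orbT.
  - by rewrite [c w2 w1]colorC eqxx ?orbT.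
rewrite cardE; apply: (@uniq_leq_size _ [:: v; w1; w2]).
  by rewrite /= !inE negb_or vw1 vw2 w12.
by move=> x; rewrite mem_enum !inE => /or3P[]/eqP->.
Qed.

(** * The whole graph: from colors to a tournament, cases (1) and (2) *)

Lemma incident_edgesP (v : V) (e : {set V}) :
  reflect (exists2 x, v != x & e = [set v; x]) (e \in incident_edges v).
Proof.
rewrite !inE; apply: (iffP andP) => [[/cards2P[x [y [xy ->]]]]|[x vx ->]].
  rewrite !inE => /orP[]/eqP->; first by exists y.
  by exists x; rewrite 1?eq_sym // setUC.
by rewrite cards2 vx !inE eqxx.
Qed.

Lemma used_colorsE : used_colors col = colors_in setT.
Proof.
rewrite /colors_in; suff -> : [set e in complete_edges V | e \subset setT] = complete_edges V by [].
by apply/setP=> e; rewrite [LHS]inE subsetT andbT.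
Qed.

Lemma mem_used_colors (x y : V) : x != y -> c x y \in used_colors col.
Proof. by rewrite used_colorsE => xy; apply/colors_inP; exists x, y. Qed.

(** Orient [x -> y] inside [T] when [x y] has color [s x]; injectivity of [s] makes this a
    tournament, and a directed 4-cycle would be properly colored. A vertex beating all others of [T]
    is monochromatic; a dominating 3-cycle is the rainbow triangle. *)
Lemma layered_colors (T : {set V}) (s : V -> C) (x0 : V) :
  x0 \in T -> {in T &, injective s} ->
  {in T, forall x y, y \notin T -> c x y = s x} ->
  {in T &, forall x y, x != y -> c x y = s x \/ c x y = s y} ->
  has_monochromatic_vertex col \/ has_dominating_rainbow_triangle col.
Proof.
move=> x0T sI sout sin.
have noC4T : {in T & &, forall x y z, {in T, forall t, uniq [:: x; y; z; t] ->
    ~ [/\ c x y == s x, c y z == s y, c z t == s z & c t x == s t]}}.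
  move=> x y z xT yT zT t tT uq [/eqP cx /eqP cy /eqP cz /eqP ct].
  have := C4_not_properly_colored uq; rewrite cx cy cz ct.
  rewrite !(inj_in_eq sI) //; move: uq; rewrite /= !inE !negb_or [t == x]eq_sym.
  case/and4P=> /and3P[xy xz xt] /andP[yz yt] zt _.
  by rewrite (negPf xy) (negPf yz) (negPf zt) (negPf xt).
have tour : {in T &, forall x y, x != y -> (c x y == s x) (+) (c y x == s y)}.
  move=> x y xT yT xy; rewrite [c y x]colorC.
  by case: (sin x y xT yT xy) => ->; rewrite eqxx (inj_in_eq sI) ?(negPf xy) // eq_sym (negPf xy).
have [[u uT dom]|[u [v [w [[uT vT wT] uq [/eqP cu /eqP cv /eqP cw] dom]]]]] :=
  tournament_no_C4 x0T tour noC4T.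
  left; exists u, (s u) => e /incident_edgesP[x ux ->].
  have [xT|xT] := boolP (x \in T); last exact: sout.
  by apply/eqP/dom; rewrite // eq_sym.
right; exists u, v, w.
have cE x : x \notin [:: u; v; w] -> [/\ c u x = s u, c v x = s v & c w x = s w].
  move=> xn; have [xT|xT] := boolP (x \in T); last by rewrite !sout.
  by have [/eqP ? /eqP ? /eqP ?] := dom x xT xn.
rewrite [c u w]colorC cu cv cw; split=> //.
- have [suv svw suw] : [/\ s u != s v, s v != s w & s u != s w].
    rewrite !(inj_in_eq sI) //; move: uq; rewrite /= !inE negb_or.
    by case/andP=> /andP[-> ->] /andP[-> _].
  have cw' : c u w = s w by rewrite colorC.
  move=> e f; rewrite !inE -!orbA => /or3P[]/eqP-> /or3P[]/eqP->;
    by rewrite ?eqxx // => _; rewrite ?cu ?cv ?cw' // eq_sym.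
- move=> e /setDP[/incident_edgesP[x ux ->]]; rewrite !inE !negb_or -andbA.
  case/and3P=> xv _ xw; suff /cE[] : x \notin [:: u; v; w] by [].
  rewrite !inE !negb_or [x == u]eq_sym ux /=.
  by apply/andP; split; [apply: contraNneq xv | apply: contraNneq xw] => ->.
- move=> e /setDP[/incident_edgesP[x vx ->]]; rewrite !inE !negb_or -andbA.
  case/and3P=> xu xw _; suff /cE[] : x \notin [:: u; v; w] by [].
  rewrite !inE !negb_or [x == v]eq_sym vx /=.
  by apply/andP; split; [apply: contraNneq xu | apply: contraNneq xw] => ->; rewrite // setUC.
- move=> e /setDP[/incident_edgesP[x wx ->]]; rewrite !inE !negb_or -andbA.
  case/and3P=> _ xv xu; suff /cE[] : x \notin [:: u; v; w] by [].
  rewrite !inE !negb_or [x == w]eq_sym wx andbT.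
  by apply/andP; split; [apply: contraNneq xu | apply: contraNneq xv] => ->; rewrite // setUC.
Qed.

(** * Spanning stars of singular edges: case (3) *)

(** The star at [v] carries [#|V|.-1] distinct colors, none of which occurs elsewhere, so exactly
    one color is left for all other edges. *)
Lemma singular_star (v : V) : size (used_colors col) = #|V| ->
  (forall w, v != w -> singular setT v w) -> has_rainbow_vertex_mono_rest col.
Proof.
move=> nC star.
have ev w : v != w -> exclusive setT v (c v w) by move=> /star/and3P[].
have inj w w' : v != w -> v != w' -> c v w = c v w' -> w = w'.
  move=> vw vw' cw; have /and3P[_ _ /exclusiveP ew] := star w vw.
  case: (ew v w' (in_setT v) (in_setT w') vw' (esym cw)) => // wE.
  by rewrite wE eqxx in vw.
pose S := [seq c v w | w <- enum (predC1 v)].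
have sizeS : size S = #|V|.-1 by rewrite size_map -cardE cardC1.
have memS a : a \in S -> exists2 w, v != w & a = c v w.
  by case/mapP=> w; rewrite mem_enum inE eq_sym; exists w.
have uS : uniq S.
  rewrite map_inj_in_uniq ?enum_uniq // => w w'.
  by rewrite !mem_enum !inE ![_ == v]eq_sym; exact: inj.
have V_gt0 : 0 < #|V| by apply/card_gt0P; exists v.
have [sub|/allPn[a aC aS]] := boolP (all (mem S) (used_colors col)).
  have := uniq_leq_size (undup_uniq _) (elimT allP sub).
  by rewrite nC sizeS leqNgt prednK // leqnn.
exists v, a; split.
- move=> e f /incident_edgesP[x vx ->] /incident_edgesP[y vy ->].
  by apply: contraNneq => /(inj _ _ vx vy) ->.
- move=> e /setDP[]; rewrite !inE => e2; rewrite e2 /=.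
  case/cards2P: e2 => [x [y [xy ->]]]; rewrite !inE negb_or => /andP[vx vy].
  apply/eqP; apply: contraT => na.
  (* A second color off the star would bring the total to [#|V|.+1]. *)
  have : size [:: a, c x y & S] <= size (used_colors col).
    apply: uniq_leq_size => [|b]; last first.
      rewrite !inE => /or3P[/eqP->|/eqP->|/memS[w vw ->]] //;
        exact: mem_used_colors.
    rewrite /= uS inE negb_or eq_sym na aS /= andbT.
    apply/negP=> /memS[w /ev ew cE].
    by have := exclusive_neq ew (in_setT x) (in_setT y) xy vx vy; rewrite cE eqxx.
  by rewrite /= nC sizeS prednK // ltnn.
- move=> e /incident_edgesP[x vx ->]; apply: contraNneq aS => <-.
  by apply/mapP; exists x; rewrite // mem_enum inE eq_sym.
Qed.

(** If neither [v0] nor [w0] is a center, some [x] is joined to [w0] but not to [v0] by a singular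
    edge, and some [y] the other way round; then [w0 x] and [v0 y] are disjoint singular edges. *)
Lemma singular_cover_star (v0 w0 : V) : singular setT v0 w0 ->
  (forall x, exists y, singular setT x y) ->
  exists v, forall w, v != w -> singular setT v w.
Proof.
move=> s0 cover; have v0w0 : v0 != w0 by case/and3P: s0.
have meet x y z t : singular setT x y -> singular setT z t -> ~~ uniq [:: x; y; z; t].
  by apply: singular_intersect => p; rewrite in_setT.
have other v w : singular setT v w -> (exists2 x, v != x & ~~ singular setT v x) ->
    exists x, [/\ v != x, w != x, ~~ singular setT v x & singular setT w x].
  move=> svw [x vx nx]; have [y sxy] := cover x.
  have wx : w != x by apply: contraNneq nx => <-.
  have [vw xy] : v != w /\ x != y by case/and3P: svw; case/and3P: sxy.
  have yv : y != v by apply: contraNneq nx => <-; rewrite singularC.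
  exists x; split=> //; rewrite singularC.
  suff <- : y = w by [].
  apply/eqP; apply: contraT => yw; have := meet _ _ _ _ svw sxy.
  by rewrite /= !inE !negb_or vw vx wx xy ![_ == y]eq_sym yv yw.
have star v : [forall w, (v != w) ==> singular setT v w] \/
    exists2 x, v != x & ~~ singular setT v x.
  have [|] := boolP [forall w, (v != w) ==> singular setT v w]; first by left.
  rewrite negb_forall => /existsP[x]; rewrite negb_imply => /andP[vx nx].
  by right; exists x.
have [/forallP h|/(other _ _ s0)[x [v0x w0x nx sx]]] := star v0.
  by exists v0 => w; exact: (implyP (h w)).
rewrite singularC in s0.
have [/forallP h|/(other _ _ s0)[y [w0y v0y ny sy]]] := star w0.
  by exists w0 => w; exact: (implyP (h w)).
have := meet _ _ _ _ sx sy.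
have xy : x != y by apply: contraNneq nx => ->.
by rewrite /= !inE !negb_or w0x w0y v0y xy [w0 == v0]eq_sym v0w0 eq_sym v0x.
Qed.

(** * An exclusive color at every vertex, and the choice of [T] *)

(** By [size_colors_in], fewer than [#|V|] colors survive the deletion of [v]. *)
Lemma exclusive_out_all (v : V) : size (used_colors col) = #|V| ->
  exists w, (v != w) && exclusive setT v (c v w).
Proof.
rewrite used_colorsE => nC; have := size_new_colors setT v.
have := size_colors_in (setT :\ v).
have : #|V| = #|[set: V] :\ v|.+1 by rewrite -cardsT (cardsD1 v) in_setT.
case E: [seq a <- _ | _] => [|a l] cV.
  by move=> le1 /leq_trans/(_ le1); rewrite nC cV ltnn.
have : a \in [seq a <- colors_in setT | a \notin colors_in (setT :\ v)].
  by rewrite E mem_head.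
rewrite mem_filter => /andP[na aC] _ _.
by have [w [_ vw <- ev]] := exclusive_out aC na; exists w; rewrite vw.
Qed.

End EdgeColoring.

Theorem theorem5 (n : nat) (V : finType) (C : eqType) (col : {set V} -> C)
    (n_gt0 : 0 < n) (card_V : #|V| = n)
    (n_colors : size (used_colors col) = n)
    (no_pc_C4 : ~ has_properly_colored_C4 col) :
  has_monochromatic_vertex col \/
  has_dominating_rainbow_triangle col \/
  has_rainbow_vertex_mono_rest col.
Proof.
subst n.
have out v := exclusive_out_all no_pc_C4 v n_colors.
have [/existsP[v0 /existsP[w0 s0]]|no_sing] :=
  boolP [exists v, exists w, singular col setT v w].
  pose T := [set x | [forall y, ~~ singular col setT x y]].
  have notinT x y : singular col setT x y -> x \notin T.
    by move=> sxy; rewrite inE negb_forall; apply/existsP; exists y; rewrite negbK.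
  have inT x : x \notin T -> exists y, singular col setT x y.
    by rewrite inE negb_forall => /existsP[y]; rewrite negbK; exists y.
  have v0T := notinT _ _ s0.
  (* An exclusive color of [x] is not that of a singular edge, so [color_to_singular] spreads it to
     every vertex outside [T]; [v0] serves as a representative of these. *)
  have sT x : x \in T -> exclusive col setT x (col [set x; v0]) /\
      forall w, w \notin T -> col [set x; w] = col [set x; v0].
    move=> xT; have [y /andP[xy ex]] := out x.
    have ny : ~~ exclusive col setT y (col [set x; y]).
      by move: xT; rewrite inE => /forallP/(_ y); rewrite /singular xy ex.
    have toK w : w \notin T -> col [set x; w] = col [set x; y].
      move=> wT; have [z swz] := inT w wT; rewrite singularC in swz.
      apply: (color_to_singular no_pc_C4 _ swz _ _ xy ex ny).
      - by move=> p; rewrite in_setT.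
      - by apply: contraTneq xT => <-; apply: notinT swz.
      - by apply: contraNneq wT => ->.
    by rewrite toK //; split=> // w wT; rewrite toK.
  have [T0|[x0 x0T]] := set_0Vmem T.
    right; right; have [v star] : exists v, forall w, v != w -> singular col setT v w.
      apply: (singular_cover_star no_pc_C4 s0) => x.
      by apply: inT; rewrite T0 inE.
    exact: singular_star n_colors star.
  apply/or_assoc; left.
  apply: (layered_colors no_pc_C4 (s := fun x => col [set x; v0]) x0T).
  - move=> x y xT yT /= eq_s; have [/exclusiveP ex _] := sT x xT.
    have yv0 : y != v0 by apply: contraNneq v0T => <-.
    case: (ex y v0 (in_setT y) (in_setT v0) yv0 (esym eq_s)) => // xv0.
    by rewrite -xv0 xT in v0T.
  - by move=> x xT y yT; exact: (sT x xT).2.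
  - move=> x y xT yT xy.
    have [[ex xK] [ey yK]] := (sT x xT, sT y yT).
    have w0T : w0 \notin T by apply: (notinT w0 v0); rewrite singularC.
    have [v0x w0x v0y w0y] : [/\ v0 != x, w0 != x, v0 != y & w0 != y].
      by split; first [apply: contraNneq v0T => -> | apply: contraNneq w0T => ->].
    have /and3P[v0w0 ev ew] := s0.
    (* In the cycle [v0 w0 x y] the singular edge differs from its neighbors, so [x y] agrees with
       [w0 x], of color [s x], or with [y v0], of color [s y]. *)
    have := C4_not_properly_colored no_pc_C4 (x := v0) (y := w0) (z := x) (t := y).
    rewrite /= !inE !negb_or v0w0 v0x w0x v0y w0y xy => /(_ isT).
    rewrite eq_sym (negPf (exclusive_neq ev _ _ w0x v0w0 v0x)) ?in_setT //=.
    rewrite [col [set w0; x]]colorC (xK w0 w0T) eq_sym => /or3P[/eqP->|/eqP->|].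
    + by left.
    + by right.
    + have [yv0 w0v0] : y != v0 /\ w0 != v0 by rewrite ![_ == v0]eq_sym.
      by rewrite (negPf (exclusive_neq ew (in_setT y) (in_setT v0) yv0 w0y w0v0)).
apply/or_assoc; left.
have {}no_sing x y : ~~ singular col setT x y.
  by apply: contra no_sing => sxy; apply/existsP; exists x; apply/existsP; exists y.
(* Without singular edges every vertex lies in [T], and [s x] is a chosen exclusive color of [x]. *)
have [phi phiP] := fin_all_exists out.
pose s x := col [set x; phi x].
have exs x : exclusive col setT x (s x) by have /andP[] := phiP x.
have sI : injective s.
  (* A color exclusive to two distinct vertices would make the edge joining them singular. *)
  move=> x y sxy; have /andP[yphi _] := phiP y; have /exclusiveP ex := exs x.
  case: (ex y (phi y) (in_setT y) (in_setT _) yphi (esym sxy)) => // xE.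
  have [cE yx] : col [set y; x] = s y /\ y != x by rewrite xE.
  by have := no_sing y x; rewrite /singular yx cE exs -sxy exs.
have [x0 _] : exists x : V, x \in V by apply/card_gt0P.
apply: (layered_colors no_pc_C4 (T := setT) (s := s) (x0 := x0)); rewrite ?in_setT //.
- by move=> x y _ _; exact: sI.
- by move=> x _ y; rewrite in_setT.
have us : uniq (map s (enum V)) by rewrite map_inj_uniq ?enum_uniq.
have sub : {subset map s (enum V) <= used_colors col}.
  by move=> a /mapP[x _ ->]; apply: mem_used_colors; have /andP[] := phiP x.
(* The [#|V|] distinct colors [s x] exhaust the used colors, so every edge has the color [s z] of
   one of its ends [z]. *)
have [|_ allE] := uniq_min_size us sub; first by rewrite size_map -cardE n_colors.
move=> x y _ _ xy; have := mem_used_colors col xy.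
rewrite -allE => /mapP[z _ cz]; have /exclusiveP ez := exs z.
by rewrite cz; case: (ez x y (in_setT x) (in_setT y) xy cz) => ->; [left | right].
Qed.
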